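(* Let $N\ge1$, $0<B<N$, $\gamma>0$, and let $U_1,\dots,U_N:[0,1]\to\mathbb{R}$ be increasing, continuously differentiable and strictly concave. Assume that the unique maximizer $\mathbf{h}^*$ of $\sum_{i=1}^N U_i(h_i)$ subject to $\sum_{i=1}^N h_i=B$ and $0\le h_i\le 1$ satisfies $0<h_i^*<1$ for all $i$. For $\alpha\ge0$ let \[ D(\alpha)=\max_{\mathbf{h}\in[0,1]^N}\Bigl\{\sum_{i=1}^N U_i(h_i)-\alpha\Bigl[\sum_{i=1}^N h_i-B\Bigr]\Bigr\}, \] and let $\mathbf{h}(\alpha)=(h_1(\alpha),\dots,h_N(\alpha))$ be the unique maximizer (so $h_i(\alpha)=(U_i')^{-1}(\alpha)$ whenever $\alpha$ is in the range of $U_i'$). Then $D$ has a unique minimizer $\alpha^*$ on $[0,\infty)$, and $V(\alpha)=D(\alpha)-D(\alpha^* )$ is a Lyapunov function for the dual dynamics \[ \dot\alpha=\begin{cases}\gamma\bigl(\sum_{i=1}^N h_i(\alpha)-B\bigr), & \alpha>0,\\ \max\bigl\{0,\gamma\bigl(\sum_{i=1}^N h_i(\alpha)-B\bigr)\bigr\}, & \alpha=0,\end{cases} \] that is, $V\ge0$, $V(\alpha)=0$ only at $\alpha=\alpha^*$, and $\dot V(\alpha)<0$ along solutions whenever $\alpha\ne\alpha^*$. Consequently, from any initial condition $\alpha(0)\ge0$, $\alpha(t)\to\alpha^*$ and $\mathbf{h}(\alpha(t))\to\mathbf{h}^*$ as $t\to\infty$.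
   Context: $h_i$ is the hit probability of file $i$ in a cache of size $B$ holding files out of $N$, and $U_i$ is the utility of file $i$. The dynamics are the continuous-time version of the dual update $\alpha\gets\max\{0,\alpha+\gamma(\sum_i h_i-B)\}$, with $h_i$ chosen to be the maximizer in $D(\alpha)$; the current number of files in the cache is identified with $\sum_i h_i$. *)

(* Defs.v *)
From HB Require Import structures.
From mathcomp Require Import all_boot all_order all_algebra.
From mathcomp Require Import all_classical all_reals all_analysis.

Set Implicit Arguments.
Unset Strict Implicit.
Unset Printing Implicit Defensive.

Import Order.TTheory GRing.Theory Num.Theory.
Import numFieldNormedType.Exports.

Local Open Scope classical_set_scope.
Local Open Scope ring_scope.

Section Optimization.
Context {R : realType} {T : Type}.

Definition maximizer_on (A : set T) (f : T -> R) (x : T) : Prop :=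
  A x /\ forall y, A y -> f y <= f x.

Definition minimizer_on (A : set T) (f : T -> R) (x : T) : Prop :=
  A x /\ forall y, A y -> f x <= f y.

End Optimization.

Section Utilities.
Context {R : realType}.

(* Derivative of f at x relative to A: on a closed interval it is the usual
   derivative at interior points and the one-sided one at endpoints. *)
Definition derivative_within (A : set R) (f : R -> R) (x l : R) : Prop :=
  (f y - f x) / (y - x) @[y --> within A x^'] --> l.

Definition C1_on (A : set R) (f : R -> R) : Prop :=
  exists df : R -> R,
    (forall x, A x -> derivative_within A f x (df x)) /\
    {within A, continuous df}.

Definition strictly_concave_on (A : set R) (f : R -> R) : Prop :=
  forall x y t, A x -> A y -> x != y -> 0 < t < 1 ->
    t * f x + (1 - t) * f y < f (t * x + (1 - t) * y).

(* Only the values of u on [0, 1] matter. Monotonicity is stated in the weak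
   form; strict concavity makes it strict. *)
Definition utility (u : R -> R) : Prop :=
  [/\ {in `[0, 1] &, {homo u : x y / x <= y}},
      C1_on `[0, 1] u &
      strictly_concave_on `[0, 1] u].

End Utilities.

Section Caching.
Context {R : realType} {N : nat}.
Variables (U : 'I_N -> R -> R) (B : R).

Definition unit_cube : set 'rV[R]_N := [set h | forall i, 0 <= h 0 i <= 1].

Definition occupancy (h : 'rV[R]_N) : R := \sum_(i < N) h 0 i.

Definition total_utility (h : 'rV[R]_N) : R := \sum_(i < N) U i (h 0 i).

Definition feasible : set 'rV[R]_N := unit_cube `&` [set h | occupancy h = B].

Definition lagrangian (a : R) (h : 'rV[R]_N) : R :=
  total_utility h - a * (occupancy h - B).

Definition dual (a : R) : R := sup [set lagrangian a h | h in unit_cube].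

(* Some maximizer of the Lagrangian on the cube (0 if there were none). *)
Definition hit_prob (a : R) : 'rV[R]_N :=
  xget 0 [set h | maximizer_on unit_cube (lagrangian a) h].

Variable gamma : R.

Definition dual_field (a : R) : R :=
  let v := gamma * (occupancy (hit_prob a) - B) in
  if 0 < a then v else Num.max 0 v.

(* The state space is [0, +oo[ and time runs over [0, +oo[; at time 0 the
   derivative is the right one. *)
Definition dual_solution (alpha : R -> R) : Prop :=
  forall t : R, 0 <= t ->
    0 <= alpha t /\
    derivative_within `[0, +oo[ alpha t (dual_field (alpha t)).

(* The decrease condition is given both for the orbital derivative, a function
   of the state, and for V composed with an arbitrary solution. *)
Definition lyapunov (V : R -> R) (astar : R) : Prop :=
  [/\ forall a : R, 0 <= a -> 0 <= V a,
      forall a : R, 0 <= a -> (V a = 0 <-> a = astar),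
      forall a : R, 0 <= a -> a != astar ->
        exists2 dV, derivative_within `[0, +oo[ V a dV & dV * dual_field a < 0 &
      forall (alpha : R -> R) (t : R), dual_solution alpha -> 0 <= t -> alpha t != astar ->
        exists2 v, derivative_within `[0, +oo[ (V \o alpha) t v & v < 0].

End Caching.

Arguments unit_cube {R} N.
Arguments feasible {R} N B.

(* Main.v *)
(* The Lagrangian separates, so h(a) is the vector of the scalar maximizers of
   U_i x - a x on [0, 1]; by strict concavity they are unique, continuous and
   nonincreasing in a. Let S a be the sum of h(a). By Danskin's envelope formula
   D' = -(S - B). Since S 0 = N > B and S vanishes for large a, the intermediate
   value theorem gives a* > 0 with S a* = B, and then h(a* ) = h*. As h* is
   interior, Fermat's rule determines a from h(a) = h*, so S - B has the sign of
   a* - a. Hence a* is the only minimizer of D, dV/dt = -gamma (S - B)^2 < 0 off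
   a*, and (alpha - a* )^2 decreases to 0 along solutions. *)
Require Import Defs.
From HB Require Import structures.
From mathcomp Require Import all_boot all_order all_algebra.
From mathcomp Require Import all_classical all_reals all_analysis.
From mathcomp Require Import ring lra.

Set Implicit Arguments.
Unset Strict Implicit.
Unset Printing Implicit Defensive.

Import Order.TTheory GRing.Theory Num.Theory.
Import numFieldNormedType.Exports.

Local Open Scope classical_set_scope.
Local Open Scope ring_scope.

(** * Calculus of derivatives relative to a set *)

Section DerivativeWithin.
Context {R : realType}.
Implicit Types (A : set R) (f g : R -> R).

(** Clearing the denominator makes the estimate trivial at [y = x], so the neighbourhood need not be
    punctured and no division survives in later bounds. *)
Lemma derivative_withinP A f x l :
  derivative_within A f x l <->
  forall e, 0 < e ->
    \forall y \near x, A y -> `|f y - f x - l * (y - x)| <= e * `|y - x|.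
Proof.
rewrite /derivative_within; split=> [/cvgrPdist_le H e e0|H].
  have := H e e0; rewrite !near_withinE; apply: filterS => y Hy Ay.
  have [->|yx] := eqVneq y x; first by rewrite !subrr mulr0 subrr normr0 mulr0.
  have yx0 : y - x != 0 by rewrite subr_eq0.
  rewrite -[f y - f x](divfK yx0) -mulrBl normrM distrC.
  by rewrite ler_wpM2r//; apply: Hy.
apply/cvgrPdist_le => e e0; rewrite !near_withinE.
apply: filterS (H e e0) => y Hy Ay yx.
have yx0 : y - x != 0 by rewrite subr_eq0.
rewrite -(@ler_pM2r _ `|y - x|) ?normr_gt0// -normrM mulrBl divfK// distrC.
exact: Hy.
Qed.

Lemma derivative_within_cvg A f x l :
  derivative_within A f x l -> f y @[y --> within A (nbhs x)] --> f x.
Proof.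
move=> /derivative_withinP fl; apply/cvgrPdist_le => e e0.
rewrite near_withinE.
have l0 : 0 < `|l| + 1 by rewrite ltr_wpDl.
near=> y => Ay.
have fy : `|f y - f x - l * (y - x)| <= 1 * `|y - x|.
  by move: Ay; near: y; exact: fl.
have xy : `|y - x| <= e / (`|l| + 1).
  rewrite distrC; near: y; apply: (@cvgr_dist_le _ _ _ _ _ id x cvg_id).
  by rewrite divr_gt0.
rewrite distrC -[f y - f x](subrK (l * (y - x))).
rewrite (le_trans (ler_normD _ _))// normrM.
rewrite (@le_trans _ _ ((`|l| + 1) * `|y - x|))//; first by lra.
by rewrite mulrC -ler_pdivlMr.
Unshelve. all: by end_near. Qed.

Lemma derivative_within_continuous A f :
  (forall x, A x -> exists l, derivative_within A f x l) ->
  {within A, continuous f}.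
Proof.
by move=> fA; apply/subspace_continuousP => x /fA[l /derivative_within_cvg].
Qed.

(** The error of [g \o f] is the error of [g] at [f y] plus [k] times the error of [f]. *)
Lemma derivative_within_comp A C f g x k l :
  (forall y, A y -> C (f y)) -> A x ->
  derivative_within C g (f x) k -> derivative_within A f x l ->
  derivative_within A (g \o f) x (k * l).
Proof.
move=> AC Ax gk fl; have fx := derivative_within_cvg fl.
move: gk fl => /derivative_withinP gk /derivative_withinP fl.
apply/derivative_withinP => e e0 /=.
(* Each of the two errors will cost at most [e / 2]; the [+ 1] keeps the denominators positive when
   [k] or [l] is 0. *)
pose d := e / (2 * (`|k| + 1)); pose c := e / (2 * (`|l| + 1)).
have k0 : 0 < 2 * (`|k| + 1) by rewrite mulr_gt0// ltr_wpDl.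
have l0 : 0 < 2 * (`|l| + 1) by rewrite mulr_gt0// ltr_wpDl.
have d0 : 0 < d by rewrite divr_gt0.
have c0 : 0 < c by rewrite divr_gt0.
have : \forall y \near within A (nbhs x), C (f y) ->
    `|g (f y) - g (f x) - k * (f y - f x)| <= c * `|f y - f x|.
  exact: fx _ (gk c c0).
rewrite near_withinE => gkc.
near=> y => Ay.
have f1 : `|f y - f x - l * (y - x)| <= 1 * `|y - x|.
  by move: Ay; near: y; exact: fl.
have f2 : `|f y - f x - l * (y - x)| <= d * `|y - x|.
  by move: Ay; near: y; exact: fl.
have g1 : `|g (f y) - g (f x) - k * (f y - f x)| <= c * `|f y - f x|.
  by have := AC _ Ay; move: Ay; near: y.
have f3 : `|f y - f x| <= (`|l| + 1) * `|y - x|.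
  rewrite -[f y - f x](subrK (l * (y - x))).
  by rewrite (le_trans (ler_normD _ _))// normrM; lra.
have -> : g (f y) - g (f x) - k * l * (y - x) =
    (g (f y) - g (f x) - k * (f y - f x)) + k * (f y - f x - l * (y - x)).
  by ring.
rewrite (le_trans (ler_normD _ _))// normrM.
have g2 : c * `|f y - f x| <= e / 2 * `|y - x|.
  rewrite (le_trans (ler_wpM2l (ltW c0) f3))// mulrA ler_wpM2r//.
  have -> // : c * (`|l| + 1) = e / 2.
  by rewrite /c; field; rewrite gt_eqF// ltr_wpDl.
have f4 : `|k| * `|f y - f x - l * (y - x)| <= e / 2 * `|y - x|.
  rewrite (le_trans (ler_wpM2l (normr_ge0 k) f2))// mulrA ler_wpM2r//.
  have -> : e / 2 = (`|k| + 1) * d.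
    by rewrite /d; field; rewrite gt_eqF// ltr_wpDl.
  by rewrite ler_wpM2r// ?ltW// ltrDl.
lra.
Unshelve. all: by end_near. Qed.

Lemma derivative_within_is_derive A f x l :
  nbhs x A -> derivative_within A f x l -> is_derive x 1 f l.
Proof.
move=> xA /derivative_withinP fl.
suff H : h^-1 *: (f (h *: 1 + x) - f x) @[h --> 0^'] --> l.
  by apply: DeriveDef; [apply/cvg_ex; exists l|exact: cvg_lim].
apply/cvgrPdist_le => e e0; rewrite near_withinE.
have H : \forall y \near x, `|f y - f x - l * (y - x)| <= e * `|y - x|.
  by apply: filterS2 xA (fl e e0) => y Ay; apply.
have c : (h *: (1 : R) + x : R) @[h --> (0 : R)] --> x.
  rewrite -[X in _ --> X]add0r -[X in _ --> X + _](@scale0r _ R 1).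
  apply: cvgD; last exact: cvg_cst.
  by apply: cvgZr_tmp; exact: cvg_id.
have : \forall h \near (0 : R), `|f (h *: 1 + x) - f x - l * (h *: 1 + x - x)|
    <= e * `|h *: 1 + x - x| by exact: c _ H.
apply: filterS => h + h0.
rewrite addrK -mulr_algl.
have -> : h%:A * 1 = h :> R by rewrite mulr1 -mulr_algl mulr1 /GRing.scale/= mulr1.
move=> Hh.
rewrite -(@ler_pM2l _ `|h|) ?normr_gt0// [leRHS]mulrC -normrM mulrBr.
rewrite /GRing.scale/= mulrA divff// mul1r distrC [h * l]mulrC.
exact: Hh.
Qed.

(** The mean value theorem asks for two-sided derivatives only strictly between [s] and [t], where
    points are interior to [[0, +oo[]; at [s = 0] continuity is enough. *)
Lemma derivative_within_le f k s t :
  (forall x, 0 <= x -> exists2 l, derivative_within `[0, +oo[ f x l & l <= k) ->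
  0 <= s <= t -> f t - f s <= k * (t - s).
Proof.
move=> fk /andP[s0]; rewrite le_eqVlt => /predU1P[->|st].
  by rewrite !subrr mulr0.
have /choice[df dfP] x : exists l, 0 <= x ->
    derivative_within `[0, +oo[ f x l /\ l <= k.
  have [x0|x0] := leP 0 x; last by exists 0.
  by have [l ? ?] := fk x x0; exists l.
have [||c] := @MVT _ f df s t st.
- move=> x; rewrite in_itv/= => /andP[sx _].
  have x0 : 0 < x by exact: le_lt_trans sx.
  apply: (@derivative_within_is_derive `[0, +oo[); last by case: (dfP x (ltW x0)).
  by near=> y; rewrite /= in_itv/= andbT ltW//; near: y; exact: lt_nbhsr.
- have : {within `[0, +oo[, continuous f}.
    apply: derivative_within_continuous => x /=; rewrite in_itv/= andbT => x0.
    by exists (df x); case: (dfP x x0).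
  apply: continuous_subspaceW => x /=.
  by rewrite !in_itv/= andbT => /andP[sx _]; exact: le_trans sx.
rewrite in_itv/= => /andP[sc _] ->.
rewrite ler_wpM2r//; first by rewrite subr_ge0 ltW.
by have [] := dfP c (ltW (le_lt_trans s0 sc)).
Unshelve. all: by end_near. Qed.

Lemma derivative_within_sqr A c x :
  derivative_within A (fun y => (y - c) ^+ 2) x (2 * (x - c)).
Proof.
apply/derivative_withinP => e e0; near=> y => _.
have -> : (y - c) ^+ 2 - (x - c) ^+ 2 - 2 * (x - c) * (y - x) =
  (y - x) * (y - x) by ring.
by rewrite normrM ler_wpM2r.
Unshelve. all: by end_near. Qed.

End DerivativeWithin.

(** * Maximizers of strictly concave functions of one variable *)

Section StrictlyConcave.
Context {R : realType}.
Implicit Types (A : set R) (f u : R -> R).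

Lemma strictly_concave_on_tilt A u a :
  strictly_concave_on A u -> strictly_concave_on A (fun x => u x - a * x).
Proof. by move=> cu x y t Ax Ay xy t01; have := cu x y t Ax Ay xy t01; lra. Qed.

(** This is strict quasi-concavity: [z] is a convex combination of [x] and [y], and a weighted mean
    is at least the minimum. *)
Lemma strictly_concave_on_min A f x y z :
  strictly_concave_on A f -> A x -> A y -> x < z < y ->
  Num.min (f x) (f y) < f z.
Proof.
move=> cf Ax Ay /andP[xz zy].
have yx0 : 0 < y - x by lra.
pose t := (y - z) / (y - x).
have t01 : 0 < t < 1.
  apply/andP; split; first by rewrite divr_gt0// subr_gt0.
  by rewrite ltr_pdivrMr//; lra.
have zE : z = t * x + (1 - t) * y by rewrite /t; field; rewrite gt_eqF.
have xy : x != y by rewrite lt_eqF//; lra.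
rewrite zE; apply: le_lt_trans (cf x y t Ax Ay xy t01).
move: (f x) (f y) t01 => p q /andP[t0 t1].
by case: (leP p q) => pq; nra.
Qed.

(** The midpoint of two distinct maximizers would do strictly better. *)
Lemma strictly_concave_maximizer_uniq (i : interval R) f x y :
  strictly_concave_on [set` i] f ->
  maximizer_on [set` i] f x -> maximizer_on [set` i] f y -> x = y.
Proof.
move=> cf; wlog xy : x y / x < y.
  move=> H Mx My; have [xy|xy|//] := ltgtP x y; first exact: H.
  by apply/esym; exact: H.
move=> [ix Mx] [iy My].
have xzy : x < (x + y) / 2 < y by lra.
have iz : [set` i] ((x + y) / 2).
  by apply: (@interval_is_interval _ i x y) => //; lra.
have := strictly_concave_on_min cf ix iy xzy.
have := Mx _ iz; have := My _ ix; have := Mx _ iy.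
by case: (leP (f x) (f y)); lra.
Qed.

(** If some [y] beat [x] by [c > 0], concavity would give a gain above [t * c] at a fraction [t] of
    the way to [y], while the derivative allows only [t * c / 2] for small [t]. *)
Lemma strictly_concave_supergradient (i : interval R) u x a :
  strictly_concave_on [set` i] u -> [set` i] x ->
  derivative_within [set` i] u x a ->
  maximizer_on [set` i] (fun y => u y - a * y) x.
Proof.
move=> cu ix /derivative_withinP ua; split=> // y iy.
rewrite leNgt; apply/negP => xy.
have yx : y != x by apply: contraTneq xy => ->; rewrite ltxx.
have yx0 : 0 < `|y - x| by rewrite normr_gt0 subr_eq0.
pose c := (u y - a * y) - (u x - a * x).
have c0 : 0 < c by rewrite subr_gt0.
have e0 : 0 < c / 2 / `|y - x| by rewrite !divr_gt0.
have [d /= d0 ud] := ua _ e0.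
(* The first bound keeps [t < 1], the second keeps the point [z] below within the radius [d] where
   the derivative estimate holds. *)
pose t := Num.min (1 / 2) (d / 2 / `|y - x|).
have t0 : 0 < t by rewrite lt_min !divr_gt0.
have t1 : t < 1 by rewrite gt_min; apply/orP; left; lra.
have td : t * `|y - x| < d.
  rewrite (@le_lt_trans _ _ (d / 2))//; last by lra.
  by rewrite -ler_pdivlMr// ge_min lexx orbT.
pose z := t * y + (1 - t) * x.
have zx : z - x = t * (y - x) by rewrite /z; ring.
have iz : [set` i] z.
  rewrite /z; have [xy'|xy'|E] := ltgtP x y; last by rewrite E eqxx in yx.
  - by apply: (@interval_is_interval _ i x y) => //; nra.
  - by apply: (@interval_is_interval _ i y x) => //; nra.
have cz : t * u y + (1 - t) * u x < u z by apply: cu => //; rewrite t0 t1.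
have := ud z; rewrite /= distrC zx normrM (gtr0_norm t0) => /(_ td iz).
rewrite ler_norml => /andP[_].
have -> : c / 2 / `|y - x| * (t * `|y - x|) = c / 2 * t.
  by field; rewrite gt_eqF.
by rewrite /c; nra.
Qed.

(** Fermat's rule: testing maximality at [x + d / 2] and [x - d / 2] bounds [l - a] by [e] from both
    sides, for every [e > 0]. *)
Lemma interior_maximizer_derivative A u x a l :
  nbhs x A -> maximizer_on A (fun y => u y - a * y) x ->
  derivative_within A u x l -> l = a.
Proof.
move=> xA [Ax Mx] /derivative_withinP ul.
apply/eqP; rewrite -subr_eq0 -normr_le0; apply/ler_addgt0Pr => e e0.
rewrite add0r.
have [d /= d0 ud] : \forall y \near x, A y /\ `|u y - u x - l * (y - x)| <= e * `|y - x|.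
  by apply: filterS2 xA (ul e e0) => y Ay; split => //; auto.
have bound s : `|s| = d / 2 -> (l - a) * s <= e * (d / 2).
  move=> sd; have := ud (x + s); rewrite /= opprD addNKr normrN sd => /(_ _)[].
    by lra.
  move=> As; rewrite [x + s]addrC addrK sd [s + x]addrC ler_norml => /andP[+ _].
  by have := Mx _ As; lra.
have d20 : 0 < d / 2 by rewrite divr_gt0.
have /= := bound (d / 2); rewrite gtr0_norm// => /(_ erefl).
have /= := bound (- (d / 2)); rewrite normrN gtr0_norm// => /(_ erefl).
rewrite mulrN -mulNr !ler_pM2r// => H1 H2.
by rewrite ler_norml H2 andbT lerNl.
Qed.

End StrictlyConcave.

(** * The scalar maximizer as a function of the multiplier *)

Section Response.
Context {R : realType}.
Implicit Types u : R -> R.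

(* The paper's [(U')^-1 a], extended to all [a] as the argmax of [u x - a * x]. *)
Definition response u (a : R) : R :=
  xget 0 [set x | maximizer_on `[0, 1] (fun y => u y - a * y) x].

Context {u : R -> R} (uU : utility u).

Lemma utility_derivative x : 0 <= x <= 1 ->
  exists l, derivative_within `[0, 1] u x l.
Proof.
by have [_ [du [uP _]] _] := uU => x01; exists (du x); apply: uP; rewrite /= in_itv.
Qed.

Lemma responseP a : maximizer_on `[0, 1] (fun y => u y - a * y) (response u a).
Proof.
suff [x ux] : exists x, maximizer_on `[0, 1] (fun y => u y - a * y) x.
  by apply: (@xgetPex _ 0 [set x | maximizer_on `[0, 1] (fun y => u y - a * y) x]);
    exists x.
have cu : {within `[0, 1], continuous (fun y : R => u y - a * y)}.
  apply/subspace_continuousP => x /=; rewrite in_itv => /utility_derivative[l].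
  move=> /derivative_within_cvg ux; apply: cvgB => //.
  apply: cvg_within_filter; apply: cvgM; [exact: cvg_cst|exact: cvg_id].
have [x x01 xM] := EVT_max ler01 cu.
by exists x; split => //.
Qed.

Lemma response_itv a : 0 <= response u a <= 1.
Proof. by have [] := responseP a; rewrite /= in_itv. Qed.

Lemma response_le a y : 0 <= y <= 1 ->
  u y - a * y <= u (response u a) - a * response u a.
Proof. by have [_ uM] := responseP a => y01; apply: uM; rewrite /= in_itv. Qed.

Lemma response_uniq a x :
  maximizer_on `[0, 1] (fun y => u y - a * y) x -> response u a = x.
Proof.
have [_ _ cu] := uU.
apply: (strictly_concave_maximizer_uniq (strictly_concave_on_tilt a cu)).
exact: responseP.
Qed.

Lemma response_derivative a x : 0 <= x <= 1 ->
  derivative_within `[0, 1] u x a -> response u a = x.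
Proof.
have [_ _ cu] := uU => x01 ua; apply: response_uniq.
by apply: strictly_concave_supergradient => //; rewrite /= in_itv.
Qed.

(** Adding the optimality inequalities at [a] and at [b] cancels [u] and leaves [(b - a) * (response
    u b - response u a) <= 0]. *)
Lemma response_antitone a b : a <= b -> response u b <= response u a.
Proof.
rewrite le_eqVlt => /predU1P[->//|ab].
have := response_le a (response_itv b); have := response_le b (response_itv a).
by nra.
Qed.

(** By Fermat's rule both multipliers equal the derivative of [u] at the common interior
    maximizer. *)
Lemma response_injective_interior a b :
  0 < response u a < 1 -> response u a = response u b -> a = b.
Proof.
move=> a01 ab.
have [l ul] := utility_derivative (response_itv a).
have n01 : nbhs (response u a) `[0, 1]%classic.
  have := near_in_itvoo; move=> /(_ R 0 1 (response u a)).
  rewrite in_itv/= => /(_ a01); apply: filterS => x /=.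
  by rewrite !in_itv/= => /andP[x0 x1]; rewrite !ltW.
rewrite -(interior_maximizer_derivative n01 (responseP a) ul).
apply: (interior_maximizer_derivative n01 _ ul).
by rewrite ab; exact: responseP.
Qed.

Lemma response0 : response u 0 = 1.
Proof.
have [mu _ _] := uU; apply: response_uniq; split=> [|y /=].
  by rewrite /= in_itv/= ler01 lexx.
rewrite in_itv/= => /andP[y0 y1]; rewrite !mul0r !subr0.
by apply: mu => //; rewrite in_itv/= ?y0 ?y1 ?ler01 ?lexx.
Qed.

(** The threshold is the right derivative [l] of [u] at 0: by concavity 0 is optimal at [l], and a
    larger multiplier only lowers the values at [y > 0]. *)
Lemma response_eq0 : exists M, forall a, M <= a -> response u a = 0.
Proof.
have [l u0] : exists l, derivative_within `[0, 1] u 0 l.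
  by apply: utility_derivative; rewrite lexx ler01.
exists l => a la; apply: response_uniq.
have l0 : response u l = 0 by apply: response_derivative; rewrite ?lexx ?ler01.
split=> [|y /=]; first by rewrite /= in_itv/= lexx ler01.
rewrite in_itv/= => y01; have := response_le l y01; rewrite l0 !mulr0.
by move: y01 => /andP[y0 _]; nra.
Qed.

(** By uniqueness the gap [d] at [a] is positive. Passing from [a] to [b] changes it by at most
    [|a - b|], since both points lie in [[0, 1]]. *)
Lemma response_strict a z : 0 <= z <= 1 -> z != response u a ->
  \forall b \near a,
    u z - b * z < u (response u a) - b * response u a.
Proof.
move=> z01 za; have r01 := response_itv a.
have d0 : 0 < u (response u a) - a * response u a - (u z - a * z).
  rewrite subr_gt0 lt_neqAle response_le// andbT.
  apply: contraNneq za => zE; apply/eqP/esym/response_uniq.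
  split=> [|y /=]; first by rewrite /= in_itv.
  by rewrite in_itv zE; exact: response_le.
move: (response u a) r01 za d0 => r r01 za; set d := (d in 0 < d) => d0.
near=> b.
have ab : `|a - b| < d.
  by near: b; exact: (@cvgr_dist_lt _ _ _ _ _ id a cvg_id).
have bd : (a - b) * (z - r) < d.
  rewrite (le_lt_trans (ler_norm _))// normrM.
  have zr : `|z - r| <= 1 by rewrite ler_norml; lra.
  by rewrite (le_lt_trans _ ab)// ler_piMr.
by rewrite /d in bd; lra.
Unshelve. all: by end_near. Qed.

Lemma response_cvg a : response u b @[b --> a] --> response u a.
Proof.
have [_ _ cu] := uU.
have r01 := response_itv a.
apply/cvgrPdist_lt => e e0.
(* For [b] near [a], the response at [b] cannot reach or pass [z]. At multiplier [b] the value at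
   [z] is below that at [response u a], hence below the maximum, so quasi-concavity forbids [z] from
   lying between the two responses. A [z] outside [[0, 1]] is never reached. *)
have far z : z != response u a -> \forall b \near a,
    ~ (response u a < z <= response u b) /\ ~ (response u b <= z < response u a).
  move=> za; have [z01|z01] := boolP (0 <= z <= 1); last first.
    near=> b; have b01 := response_itv b.
    by split => zb; move/negP: z01; apply; lra.
  apply: filterS (response_strict z01 za) => b zb.
  have cb := strictly_concave_on_tilt b cu.
  have ra := (responseP a).1; have rb := (responseP b).1.
  have ba := response_le b r01.
  split => /andP[].
    move=> az; rewrite le_eqVlt => /predU1P[E|zrb]; first by rewrite -E in ba; lra.
    have /= := strictly_concave_on_min cb ra rb (introT andP (conj az zrb)).
    by rewrite gt_min => /orP[]; lra.
  rewrite le_eqVlt => /predU1P[E|zrb] az; first by rewrite E in ba; lra.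
  have /= := strictly_concave_on_min cb rb ra (introT andP (conj zrb az)).
  by rewrite gt_min => /orP[]; lra.
have f1 : response u a + e != response u a by rewrite gt_eqF// ltrDl.
have f2 : response u a - e != response u a by rewrite lt_eqF// ltrBlDr ltrDl.
apply: filterS2 (far _ f1) (far _ f2) => b [H1 _] [_ H2].
rewrite ltr_norml; apply/andP; split; rewrite ltNge; apply/negP => H.
  by apply: H1; lra.
by apply: H2; lra.
Unshelve. all: by end_near. Qed.

End Response.

(** * The separable Lagrangian, its dual function and the total occupancy *)

Section DualProblem.
Context {R : realType} {N : nat} {U : 'I_N -> R -> R}.
Context (HU : forall i, utility (U i)) (B : R).
Implicit Types (a b : R) (h : 'rV[R]_N).

Local Notation hit := (hit_prob U B).
Local Notation S a := (occupancy (hit a)).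

Lemma lagrangianE a h :
  lagrangian U B a h = \sum_(i < N) (U i (h 0 i) - a * h 0 i) + a * B.
Proof.
by rewrite /lagrangian /total_utility /occupancy sumrB -mulr_sumr; ring.
Qed.

(** For the forward direction compare [h] with the vector [g] of responses: every term of the
    difference is nonpositive and the sum is nonnegative, so each term vanishes and each coordinate
    is a scalar maximizer. *)
Lemma lagrangian_maximizerP a h :
  maximizer_on (unit_cube N) (lagrangian U B a) h <->
  forall i, h 0 i = response (U i) a.
Proof.
pose g := \row_i response (U i) a.
have gE i : g 0 i = response (U i) a by rewrite mxE.
have gC : unit_cube N g by move=> i; rewrite gE; exact: response_itv.
have term k (i : 'I_N) : unit_cube N k ->
    U i (k 0 i) - a * k 0 i <= U i (g 0 i) - a * g 0 i.
  by move=> kC; rewrite gE response_le.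
split=> [[hC hM] i|hE]; last first.
  have -> : h = g by apply/rowP => i; rewrite hE gE.
  split=> // k kC; rewrite !lagrangianE lerD2r.
  by apply: ler_sum => i _; exact: term.
have := hM _ gC; rewrite !lagrangianE lerD2r -subr_ge0 -sumrB => sum_ge0.
apply/esym/response_uniq => //; split=> [|y /=]; first by rewrite /= in_itv/=.
rewrite in_itv/= => y01.
rewrite (le_trans (response_le (HU i) a y01))// -gE.
move: sum_ge0; rewrite (bigD1 i)//= => sum_ge0.
rewrite -subr_ge0 (le_trans sum_ge0)// gerDl sumr_le0// => j _.
by rewrite subr_le0 term.
Qed.

Lemma hit_probP a : maximizer_on (unit_cube N) (lagrangian U B a) (hit a).
Proof.
apply: (@xgetPex _ 0 [set h | maximizer_on (unit_cube N) (lagrangian U B a) h]).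
by exists (\row_i response (U i) a); apply/lagrangian_maximizerP => i; rewrite mxE.
Qed.

Lemma hit_probE a i : hit a 0 i = response (U i) a.
Proof. by move: i; apply/lagrangian_maximizerP/hit_probP. Qed.

Lemma hit_prob_uniq a h :
  maximizer_on (unit_cube N) (lagrangian U B a) h -> hit a = h.
Proof.
by move=> /lagrangian_maximizerP hE; apply/rowP => i; rewrite hE hit_probE.
Qed.

Lemma dualE a : dual U B a = lagrangian U B a (hit a).
Proof.
have [hC hM] := hit_probP a; apply/eqP; rewrite eq_le; apply/andP; split.
  by apply: ge_sup => [|_ [h /hM ? <-]//]; exists (lagrangian U B a (hit a)), (hit a).
apply: ub_le_sup; last by exists (hit a).
by exists (lagrangian U B a (hit a)) => _ [h /hM ? <-].
Qed.

(* [B - S a] is a subgradient of [dual] at [a]. *)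
Lemma dual_subgradient a b : dual U B a - (b - a) * (S a - B) <= dual U B b.
Proof.
rewrite !dualE; have [hC _] := hit_probP a; have [_ hM] := hit_probP b.
by apply: le_trans (hM _ hC); rewrite /lagrangian; lra.
Qed.

Lemma occupancy_hitE a : S a = \sum_(i < N) response (U i) a.
Proof. by apply: eq_bigr => i _; rewrite hit_probE. Qed.

Lemma occupancy_hit_antitone a b : a <= b -> S b <= S a.
Proof.
by move=> ab; rewrite !occupancy_hitE ler_sum// => i _; exact: response_antitone.
Qed.

Lemma occupancy_hit_cvg a : S b @[b --> a] --> S a.
Proof.
rewrite occupancy_hitE; under eq_fun do rewrite occupancy_hitE.
apply: cvg_big => [|i _]; last exact: response_cvg.
exact: add_continuous.
Qed.

Lemma hit_prob_cvg a : hit b @[b --> a] --> hit a.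
Proof.
apply/cvg_ballP => e e0; near=> b; split => // i j.
rewrite ord1 !hit_probE; move: j; near: b.
apply: filter_forall => j.
exact: (cvg_ball (response_cvg (HU j) (a := a))).
Unshelve. all: by end_near. Qed.

Lemma occupancy_hit0 : S 0 = N%:R.
Proof.
rewrite occupancy_hitE (eq_bigr (fun=> 1)) => [|i _]; last exact: response0.
by rewrite sumr_const card_ord.
Qed.

Lemma occupancy_hit_eq0 : exists2 M, 0 <= M & S M = 0.
Proof.
have /choice[M MP] i := response_eq0 (HU i).
(* A single nonnegative bound for all the thresholds [M i]. *)
exists (\sum_(i < N) `|M i|); first exact: sumr_ge0.
rewrite occupancy_hitE big1// => i _; apply: MP.
by rewrite (le_trans (ler_norm _))// (bigD1 i)//= lerDl sumr_ge0.
Qed.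

(** The subgradient inequalities at [a] and at [b] place the linearization error between 0 and
    [(b - a) * (S a - S b)], which is [o(b - a)] by continuity of the occupancy. *)
Lemma dual_derivative A a : derivative_within A (dual U B) a (- (S a - B)).
Proof.
apply/derivative_withinP => e e0.
have /cvgrPdist_le/(_ e e0) := @occupancy_hit_cvg a; apply: filterS => b Sab _.
have := dual_subgradient a b; have := dual_subgradient b a.
have eb : `|(b - a) * (S a - S b)| <= e * `|b - a|.
  by rewrite normrM mulrC ler_wpM2r.
by move: eb; rewrite !ler_norml; lra.
Qed.

Lemma exists_occupancy_hit : 0 < B < N%:R -> exists2 a, 0 < a & S a = B.
Proof.
move=> /andP[B0 BN]; have [M M0 SM] := occupancy_hit_eq0.
have cS : {within `[0, M], continuous (fun a => S a)}.
  by apply: continuous_subspaceT => a; exact: occupancy_hit_cvg.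
have [|a a0M SaB] := IVT M0 cS (v := B).
  by rewrite SM occupancy_hit0 ge_min le_max (ltW B0) (ltW BN) orbT.
exists a => //; move: a0M; rewrite in_itv/= => /andP[a0 _].
rewrite lt_neqAle a0 andbT; apply: contraTneq BN => a0'.
by rewrite -SaB -a0' occupancy_hit0 ltxx.
Qed.

(** Lagrangian sufficiency: on feasible vectors the Lagrangian equals the total utility, so [hit a]
    is optimal. Any other optimum reaches the same Lagrangian value, hence maximizes it over the
    whole cube and equals [hit a] by uniqueness. *)
Lemma feasible_maximizer a h : S a = B ->
  maximizer_on (feasible N B) (total_utility U) h <-> h = hit a.
Proof.
move=> SaB; have [hC hM] := hit_probP a.
have LE k : occupancy k = B -> lagrangian U B a k = total_utility U k.
  by move=> kB; rewrite /lagrangian kB subrr mulr0 subr0.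
have hitM : maximizer_on (feasible N B) (total_utility U) (hit a).
  by split=> // k [kC kB]; rewrite -!LE//; exact: hM.
split=> [[[kC kB] kM]|->//].
apply/esym/hit_prob_uniq; split=> // k' /hM /le_trans; apply.
by rewrite !LE//; apply: kM; exact: hitM.1.
Qed.

Lemma hit_prob_injective_interior a b i :
  0 < hit a 0 i < 1 -> hit a = hit b -> a = b.
Proof.
rewrite hit_probE => ai ab; apply: (response_injective_interior (HU i) ai).
by rewrite -!hit_probE ab.
Qed.

End DualProblem.

(** * Convergence of a scalar flow pointing towards [c] *)

Section ScalarFlow.
Context {R : realType}.
Implicit Types F alpha : R -> R.

(* [(alpha t - c)^2] is nonincreasing, and decreases at a linear rate as long as
   [alpha t] stays away from [c]. *)
Lemma scalar_flow_cvg F alpha c :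
  (forall e, 0 < e -> exists2 m, 0 < m &
    forall x, 0 <= x -> e <= `|x - c| -> (x - c) * F x <= - m) ->
  (forall t, 0 <= t ->
    0 <= alpha t /\ derivative_within `[0, +oo[ alpha t (F (alpha t))) ->
  alpha t @[t --> +oo] --> c.
Proof.
move=> Fc alphaF; pose W t := (alpha t - c) ^+ 2.
have dW t : 0 <= t ->
    derivative_within `[0, +oo[ W t (2 * (alpha t - c) * F (alpha t)).
  move=> t0; have [_ dalpha] := alphaF t t0.
  have t0' : `[0, +oo[%classic t by rewrite /= in_itv/= t0.
  exact: (derivative_within_comp (C := setT) (fun _ _ => I) t0'
    (@derivative_within_sqr _ _ c _) dalpha).
have F0 x : 0 <= x -> (x - c) * F x <= 0.
  move=> x0; have [->|xc] := eqVneq x c; first by rewrite subrr mul0r.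
  have [|m m0 /(_ x x0 (lexx _))] := Fc `|x - c|.
    by rewrite normr_gt0 subr_eq0.
  by lra.
have W_noninc s t : 0 <= s <= t -> W t <= W s.
  move=> st; rewrite -subr_le0 -[leRHS](mul0r (t - s)).
  apply: derivative_within_le => // x x0; exists (2 * (alpha x - c) * F (alpha x)).
    exact: dW.
  by have := F0 _ (alphaF x x0).1; lra.
apply/cvgrPdist_lt => e e0; have [m m0 Fm] := Fc e e0.
have [T T0 Te] : exists2 T, 0 <= T & `|alpha T - c| < e.
  apply: contrapT => far.
  have {}far t : 0 <= t -> e <= `|alpha t - c|.
    by move=> t0; rewrite leNgt; apply/negP => te; apply: far; exists t.
  (* Decreasing at rate [2 * m] up to this time would bring [W] down to at most [- 2 * m], although
     it is a square. *)
  pose T := W 0 / (2 * m) + 1.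
  have T0 : 0 <= T.
    by rewrite addr_ge0// divr_ge0 ?sqr_ge0// mulr_ge0// ltW.
  have : W T - W 0 <= - (2 * m) * (T - 0).
    apply: derivative_within_le; last by rewrite lexx.
    move=> x x0; exists (2 * (alpha x - c) * F (alpha x)); first exact: dW.
    by have := Fm _ (alphaF x x0).1 (far x x0); lra.
  have -> : - (2 * m) * (T - 0) = - W 0 - 2 * m.
    by rewrite /T; field; rewrite gt_eqF.
  by have : 0 <= W T := sqr_ge0 _; lra.
near=> t.
have Tt : T <= t by near: t; apply: nbhs_pinfty_ge; rewrite num_real.
(* Monotonicity of [W] keeps the solution within [e] of [c] after time [T]. *)
have := W_noninc T t; rewrite T0 Tt => /(_ isT); rewrite /W => Wt.
rewrite distrC -(@ltr_pXn2r _ 2)// ?nnegrE// ?ltW//.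
rewrite real_normK ?num_real// (le_lt_trans Wt)//.
by rewrite -(real_normK (num_real (alpha T - c))) ltr_pXn2r// nnegrE// ltW.
Unshelve. all: by end_near. Qed.

End ScalarFlow.

(** * Lyapunov property and convergence of the dual dynamics *)

Section DualDynamics.
Context {R : realType} {N : nat} {U : 'I_N -> R -> R}.
Context (HU : forall i, utility (U i)) {B gamma astar : R}.
Context (gamma_gt0 : 0 < gamma) (astar_gt0 : 0 < astar).

Local Notation S a := (occupancy (hit_prob U B a)).

Context (Sastar : S astar = B).
Context (S_inj : forall a, S a = B -> a = astar).

(** Antitonicity gives the weak inequality, and [S_inj] excludes equality. *)
Lemma occupancy_hit_lt a : astar < a -> S a < B.
Proof.
move=> aa; rewrite lt_neqAle -[leRHS]Sastar occupancy_hit_antitone ?ltW// andbT.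
by apply: contraTneq aa => /S_inj ->; rewrite ltxx.
Qed.

Lemma occupancy_hit_gt a : a < astar -> B < S a.
Proof.
move=> aa; rewrite lt_neqAle -[leLHS]Sastar occupancy_hit_antitone ?ltW// andbT.
by apply: contraTneq aa => /esym/S_inj ->; rewrite ltxx.
Qed.

(* The projection at [0] is inactive, since [S 0 > B]. *)
Lemma dual_fieldE a : 0 <= a -> dual_field U B gamma a = gamma * (S a - B).
Proof.
rewrite /dual_field le_eqVlt => /predU1P[<-|->//]; rewrite ltxx.
by apply/max_r; rewrite mulr_ge0 ?ltW// subr_gt0 occupancy_hit_gt.
Qed.

Lemma dual_ge_min a : dual U B astar <= dual U B a.
Proof.
by have := dual_subgradient HU B astar a; rewrite Sastar subrr mulr0 subr0.
Qed.

(** If [a] differed from [astar], the strict sign of [S c - B] at the midpoint [c] and the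
    subgradient inequality there would make [dual U B c] smaller than the minimum. *)
Lemma dual_eq_min a : dual U B a = dual U B astar -> a = astar.
Proof.
move=> aE; pose c := (a + astar) / 2.
have := dual_subgradient HU B c a; have := dual_ge_min c; rewrite aE.
have [aa|aa|//] := ltgtP a astar.
- have : B < S c by apply: occupancy_hit_gt; rewrite /c; lra.
  by rewrite /c; nra.
- have : S c < B by apply: occupancy_hit_lt; rewrite /c; lra.
  by rewrite /c; nra.
Qed.

Lemma dual_lyapunov :
  lyapunov U B gamma (fun a => dual U B a - dual U B astar) astar.
Proof.
have dV A a : derivative_within A (fun a => dual U B a - dual U B astar) a
    (- (S a - B)).
  apply/derivative_withinP => e e0.
  have /derivative_withinP := @dual_derivative _ _ _ HU B A a.
  move=> /(_ e e0); apply: filterS => b H bA; have := H bA.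
  suff -> : dual U B b - dual U B astar - (dual U B a - dual U B astar) =
    dual U B b - dual U B a by [].
  by ring.
have neg a : 0 <= a -> a != astar -> - (S a - B) * dual_field U B gamma a < 0.
  move=> a0 aa; rewrite dual_fieldE// mulrCA pmulr_rlt0// mulNr oppr_lt0.
  rewrite -expr2 exprn_even_gt0//= subr_eq0.
  by apply: contra_neq aa; exact: S_inj.
split=> [a a0|a a0|a a0 aa|alpha t alphaS t0 aa].
- by rewrite subr_ge0 dual_ge_min.
- split=> [/subr0_eq/dual_eq_min//|->]; exact: subrr.
- by exists (- (S a - B)); [exact: dV|exact: neg].
- have [a0 da] := alphaS t t0.
  exists (- (S (alpha t) - B) * dual_field U B gamma (alpha t)); last exact: neg.
  (* The dual is differentiable on the whole line, so [setT] serves as the outer domain even where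
     [alpha t] is 0. *)
  apply: (derivative_within_comp (C := setT)) => //.
  by rewrite /= in_itv/= t0.
Qed.

Lemma dual_solution_cvg alpha :
  dual_solution U B gamma alpha -> alpha t @[t --> +oo] --> astar.
Proof.
apply: scalar_flow_cvg => e e0.
have S1 : S (astar + e) < B by apply: occupancy_hit_lt; rewrite ltrDl.
have S2 : B < S (astar - e) by apply: occupancy_hit_gt; rewrite ltrBlDr ltrDl.
(* By antitonicity, at distance at least [e] from [astar] the imbalance [|S x - B|] is at least the
   smaller of its values at [astar + e] and [astar - e]. The latter point may be negative, where [S]
   is still defined and antitone. *)
exists (e * (gamma * Num.min (B - S (astar + e)) (S (astar - e) - B))).
  by rewrite !mulr_gt0// lt_min !subr_gt0 S1 S2.
move=> x x0 xe; rewrite dual_fieldE// mulrCA [e * _]mulrCA -mulrN ler_pM2l//.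
set m := Num.min _ _.
have [m1 m2] : m <= B - S (astar + e) /\ m <= S (astar - e) - B.
  by split; rewrite ge_min lexx ?orbT.
have m0 : 0 < m by rewrite lt_min !subr_gt0 S1 S2.
have [xa|xa] := leP astar x.
  rewrite ger0_norm ?subr_ge0// in xe.
  have : S x <= S (astar + e) by apply: occupancy_hit_antitone => //; lra.
  by nra.
rewrite ltr0_norm ?subr_lt0// in xe.
have : S (astar - e) <= S x by apply: occupancy_hit_antitone => //; lra.
by nra.
Qed.

End DualDynamics.

Theorem mainTheorem4 (R : realType) (N : nat) (B gamma : R)
    (U : 'I_N -> R -> R) (hstar : 'rV[R]_N) :
  (1 <= N)%N -> 0 < B < N%:R -> 0 < gamma ->
  (forall i, utility (U i)) ->
  maximizer_on (feasible N B) (total_utility U) hstar ->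
  (forall i, 0 < hstar 0 i < 1) ->
  [/\ unique (maximizer_on (feasible N B) (total_utility U)) hstar,
      forall a : R, 0 <= a ->
        [/\ unique (maximizer_on (unit_cube N) (lagrangian U B a))
              (hit_prob U B a),
            dual U B a = lagrangian U B a (hit_prob U B a) &
            forall (i : 'I_N) (x : R), 0 <= x <= 1 -> derivative_within `[0, 1] (U i) x a ->
              hit_prob U B a 0 i = x] &
      exists astar : R,
        [/\ unique (minimizer_on `[0, +oo[ (dual U B)) astar,
            lyapunov U B gamma (fun a => dual U B a - dual U B astar) astar &
            forall alpha : R -> R, dual_solution U B gamma alpha ->
              alpha t @[t --> +oo] --> astar /\
              hit_prob U B (alpha t) @[t --> +oo] --> hstar]].
Proof.
move=> N1 B0N g0 HU hM h01.
have [astar a0 Sa] := exists_occupancy_hit HU B0N.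
have hE : hstar = hit_prob U B astar by apply/(feasible_maximizer HU _ Sa).
(* Every multiplier that balances the occupancy yields the same optimum [hstar], and one interior
   coordinate of it determines the multiplier; [N1] supplies that coordinate. *)
have S_inj a : occupancy (hit_prob U B a) = B -> a = astar.
  move=> SaB; apply/esym/(hit_prob_injective_interior HU (B := B) (i := Ordinal N1)).
    by rewrite -hE.
  by rewrite -hE; apply/(feasible_maximizer HU _ SaB).
split.
- by split=> // h /(feasible_maximizer HU _ Sa) ->.
- move=> a _; split; first by split; [exact: hit_probP|exact: hit_prob_uniq].
    exact: dualE.
  by move=> i x x01 Ux; rewrite hit_probE//; exact: response_derivative.
exists astar; split.
- split=> [|a [_ aM]].
    split=> [|a _]; first by rewrite /= in_itv/= ltW.
    exact: dual_ge_min.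
  apply/esym/(dual_eq_min HU Sa S_inj)/le_anti/andP; split; last exact: dual_ge_min.
  by apply: aM; rewrite /= in_itv/= ltW.
- exact: dual_lyapunov.
- move=> alpha alphaS.
  have ac := dual_solution_cvg HU g0 a0 Sa S_inj alphaS.
  by split=> //; rewrite hE; apply: (cvg_comp _ _ ac); exact: hit_prob_cvg.
Qed.
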